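(* Consider on every element of the mesh of $S$ the flux-differencing semi-discretization $$ \begin{aligned} \omega_i\omega_j J_{ij}\frac{\mathrm d}{\mathrm dt}\boldsymbol u_{ij} &= \omega_j\Big(-\sum_{m=0}^N S_{im}(J\boldsymbol f^1)^{\#}_{ij,mj}+\delta_{i0}(J\boldsymbol f^1)^{*}_{0j,0j^+}-\delta_{iN}(J\boldsymbol f^1)^{*}_{Nj,Nj^+}\Big)\\ &\quad+\omega_i\Big(-\sum_{m=0}^N S_{jm}(J\boldsymbol f^2)^{\#}_{ij,im}+\delta_{j0}(J\boldsymbol f^2)^{*}_{i0,i0^+}-\delta_{jN}(J\boldsymbol f^2)^{*}_{iN,iN^+}\Big)+\omega_i\omega_jJ_{ij}\boldsymbol s_{ij},\quad 0\le i,j\le N, \end{aligned} $$ where, for $j\in\{1,2\}$, the volume flux is $(J\boldsymbol f^j)^{\#}_{L,R}=(\phi^j_0,\phi^j_1,\phi^j_2)^{\mathrm T}$ with $\phi^j_0=\frac12[(Jhv^j)_L+(Jhv^j)_R]$ and, for $i\in\{1,2\}$, $$\phi^j_i=\tfrac14\big[(Jhv^jv^i)_L+(Jhv^jv^i)_R+(Jhv^j)_R(v^i)_L+(G^{ik}Jhv^j)_L(v_k)_R\big]+\tfrac g2(G^{ij}Jh)_Lh_R+\tfrac g2(G^{ij}Jh)_L(b_R-b_L),$$ the interface flux is $$(J\boldsymbol f^j)^{*}_{L,R}=(J\boldsymbol f^j)^{\#}_{L,R}-\tfrac{J_L}{2}\max(\lambda^j_L,\lambda^j_R)(\boldsymbol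 u_R-\boldsymbol u_L),\qquad \lambda^j=|v^j|+\sqrt{ghG^{jj}},$$ and the source term is $\boldsymbol s=(0,s^1,s^2)^{\mathrm T}$ with $s^i=-\frac12\big(\Gamma^i_{jk}hv^jv^k-G^{ik}\Gamma^l_{jk}hv^jv_l\big)-fJG^{ij}\varepsilon_{jk}hv^k$. Assume that the bottom topography $b$ is continuous. Then the scheme is well balanced in the sense that any solution satisfying, everywhere on $S$, $$h+b=\mathrm{constant},\qquad \vec v=\vec 0,$$ results in $\mathrm d\boldsymbol u_{ij}/\mathrm dt=\boldsymbol 0$ (for all nodes of all elements).
   Context: Summation over Latin indices in $\{1,2\}$ repeated in upper and lower positions is implied for tensor components (not for $j$ in $G^{jj}$, nor for node indices). $S\subset\mathbb R^3$ is a spherical shell (a closed surface), tessellated by a conforming mesh of quadrilateral elements $E$, each the image of $[-1,1]^2$ (coordinates $\xi^1,\xi^2$) under a smooth, bijective, time-invariant mapping $\vec X$. With $\vec a_i=\partial_i\vec X$: $G_{ij}=\vec a_i\cdot\vec a_j$, $\boldsymbol G=(G_{ij})$ is symmetric positive definite with inverse $(G^{ij})$, $J=\sqrt{\det\boldsymbol G}$, $\Gamma^i_{jk}=\frac12G^{il}(\partial_jG_{kl}+\partial_kG_{jl}-\partial_lG_{jk})$. Velocity $\vec v=v^i\vec a_i$, with $v_i=G_{ij}v^j$. $h>0$ is the fluid depth, $g>0$ constant gravity, $b$ the time-independent bottom topography, $f$ the Coriolis parameter, $\varepsilon_{12}=1$, $\varepsilon_{21}=-1$, $\varepsilon_{11}=\varepsilon_{22}=0$.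 State: $\boldsymbol u=(h,hv^1,hv^2)^{\mathrm T}$. Let $\{\xi_i\}_{i=0}^N\subset[-1,1]$ be the Legendre--Gauss--Lobatto nodes (including endpoints) with positive weights $\omega_i$ and Lagrange polynomials $\ell_i$. $(\cdot)_{ij}$ denotes a quantity at $(\xi_i,\xi_j)$. Matrices (zero-based indices): $D_{ij}=\ell_j'(\xi_i)$, $M_{ij}=\omega_i\delta_{ij}$, $\boldsymbol Q=\boldsymbol M\boldsymbol D$, $\boldsymbol B=\mathrm{diag}(-1,0,\dots,0,1)$, $\boldsymbol S=2\boldsymbol Q-\boldsymbol B$. They satisfy $\boldsymbol Q+\boldsymbol Q^{\mathrm T}=\boldsymbol B$ and $\sum_mD_{im}=0$. In $(J\boldsymbol f^k)^{\#}_{L,R}$, subscripts $L,R$ denote evaluation at two nodes; e.g. $(J\boldsymbol f^1)^{\#}_{ij,mj}$ has left state at $(\xi_i,\xi_j)$ and right state at $(\xi_m,\xi_j)$. A subscript with superscript ''$+$'' denotes the external state at the coincident node of the adjacent element: its momentum components are transformed to the local basis of the interior node (so that they represent the same tangent vector), and, in interface fluxes, all geometric quantities ($J$, $G_{ij}$, $G^{ij}$) for both arguments are evaluated on the interior side (first subscript). Continuity of $b$ implies that $b$ takes equal values at coincident interface nodes. *)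

(* Defs.v *)
(* Tensor indices in {1,2} are ordinals 'I_2, so that
   the coordinate directions 1 and 2 are [ord0] and [ord_max]. *)
From HB Require Import structures.
From mathcomp Require Import all_boot all_order all_algebra.
From mathcomp Require Import all_classical all_reals all_analysis.
Import Order.TTheory GRing.Theory Num.Theory.
Import numFieldNormedType.Exports.

Set Implicit Arguments.
Unset Strict Implicit.
Unset Printing Implicit Defensive.

Local Open Scope classical_set_scope.
Local Open Scope ring_scope.

(** * Legendre--Gauss--Lobatto collocation *)

(* Rodrigues' formula. *)
Definition legendre (R : realType) (N : nat) : {poly R} :=
  ((2 ^ N * N`!)%:R)^-1 *: (('X^2 - 1) ^+ N)^`(N).

Record lgl_nodes (R : realType) (N : nat) (xi : 'I_N.+1 -> R) : Prop :=
  LGLNodes {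
    lgl_first : xi ord0 = -1;
    lgl_last : xi ord_max = 1;
    lgl_incr : forall i j : 'I_N.+1, (i < j)%N -> xi i < xi j;
    lgl_inner : forall i : 'I_N.+1, i != ord0 -> i != ord_max ->
      root (legendre R N)^`() (xi i) }.

Section Collocation.
Variables (R : realType) (N : nat) (xi : 'I_N.+1 -> R).

(* The classical closed form of the Lobatto quadrature weights. *)
Definition lgl_weight (i : 'I_N.+1) : R :=
  2 / ((N * N.+1)%:R * (legendre R N).[xi i] ^+ 2).

Definition lagrange_poly (j : 'I_N.+1) : {poly R} :=
  \prod_(k < N.+1 | k != j) ((xi j - xi k)^-1 *: ('X - (xi k)%:P)).

Definition Dmx : 'M[R]_N.+1 := \matrix_(i, j) ((lagrange_poly j)^`()).[xi i].
Definition Mmx : 'M[R]_N.+1 := diag_mx (\row_i lgl_weight i).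
Definition Qmx : 'M[R]_N.+1 := Mmx *m Dmx.
Definition Bmx : 'M[R]_N.+1 :=
  diag_mx (\row_i ((i == ord_max)%:R - (i == ord0)%:R)).
Definition Smx : 'M[R]_N.+1 := 2 *: Qmx - Bmx.

Definition node (i j : 'I_N.+1) : 'rV[R]_2 :=
  \row_k (if k == ord0 then xi i else xi j).

End Collocation.

(** * Geometry of an element *)

Definition vdot (R : realType) (n : nat) (x y : 'rV[R]_n) : R :=
  \sum_k x ord0 k * y ord0 k.

Definition sphere (R : realType) (c : 'rV[R]_3) (r : R) : set 'rV[R]_3 :=
  [set x | vdot (x - c) (x - c) = r ^+ 2].

Definition square (R : realType) : set 'rV[R]_2 :=
  [set x | forall k, -1 <= x ord0 k <= 1].

Definition open_square (R : realType) : set 'rV[R]_2 :=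
  [set x | forall k, -1 < x ord0 k < 1].

Arguments square : clear implicits.
Arguments open_square : clear implicits.

Section Geometry.
Variables (R : realType) (X : 'rV[R]_2 -> 'rV[R]_3).

Definition iter_partial (s : seq 'I_2) : 'rV[R]_2 -> 'rV[R]_3 :=
  foldr (fun k F => fun x => 'D_(delta_mx ord0 k) F x) X s.

(* C^infinity up to the boundary: [X] restricts a map, defined on an open
   neighbourhood of the closed square, whose partial derivatives of every order
   are differentiable. *)
Definition smooth_on_square : Prop :=
  exists U : set 'rV[R]_2, [/\ open U, square R `<=` U &
    forall (s : seq 'I_2) x, U x -> differentiable (iter_partial s) x].

Definition tangent (i : 'I_2) (x : 'rV[R]_2) : 'rV[R]_3 :=
  'D_(delta_mx ord0 i) X x.

Definition metric (x : 'rV[R]_2) : 'M[R]_2 :=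
  \matrix_(i, j) vdot (tangent i x) (tangent j x).

Definition dmetric (j k l : 'I_2) (x : 'rV[R]_2) : R :=
  'D_(delta_mx ord0 j) (fun y => metric y k l : R) x.

(* [christoffel i j k] has upper index [i]. *)
Definition christoffel (i j k : 'I_2) (x : 'rV[R]_2) : R :=
  2^-1 * \sum_l invmx (metric x) i l *
    (dmetric j k l x + dmetric k j l x - dmetric l j k x).

End Geometry.

Definition posdef (R : realType) (n : nat) (G : 'M[R]_n) : Prop :=
  G^T = G /\ forall w : 'rV[R]_n, w != 0 -> 0 < (w *m G *m w^T) ord0 ord0.

(** * Mesh *)

(* The edge [(d, s)] of the reference square is where coordinate [d] equals
   1 if [s], and -1 otherwise. *)
Definition edge : Type := ('I_2 * bool)%type.

Definition edge_point (R : realType) (a : edge) (t : R) : 'rV[R]_2 :=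
  \row_k (if k == a.1 then (if a.2 then 1 else -1) else t).

Definition edge_image (R : realType) (X : 'rV[R]_2 -> 'rV[R]_3) (a : edge) :
    set 'rV[R]_3 :=
  [set X (edge_point a t) | t in [set t : R | -1 <= t <= 1]].

(* The indices of the [k]-th node on an edge. *)
Definition edge_index (N : nat) (a : edge) (k : 'I_N.+1) :
    'I_N.+1 * 'I_N.+1 :=
  let q := if a.2 then ord_max else ord0 in
  if a.1 == ord0 then (q, k) else (k, q).

(* [adj e a] is the element adjacent to [e] across its edge [a], together with
   the name of the shared edge in that element.  Elements meet along full edges
   only, so there are no hanging nodes. *)
Record conforming_mesh (R : realType) (E : finType) (S : set 'rV[R]_3)
    (X : E -> 'rV[R]_2 -> 'rV[R]_3) (adj : E -> edge -> E * edge) : Prop :=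
  ConformingMesh {
    mesh_smooth : forall e, smooth_on_square (X e);
    mesh_inj : forall e x y, square R x -> square R y ->
      X e x = X e y -> x = y;
    mesh_posdef : forall e x, square R x -> posdef (metric (X e) x);
    mesh_cover : \bigcup_(e in [set: E]) (X e @` square R) = S;
    mesh_disjoint : forall e e', e != e' ->
      (X e @` open_square R) `&` (X e' @` square R) = set0;
    mesh_adj_neq : forall e a, (adj e a).1 != e;
    mesh_adj : forall e a,
      edge_image (X (adj e a).1) (adj e a).2 = edge_image (X e) a }.

(* [coin e a k] is the index, along the shared edge as seen from the adjacent
   element, of the node that coincides with the [k]-th node on edge [a] of [e];
   it accounts for the relative orientation of the two elements. *)
Definition coincident_nodes (R : realType) (E : finType) (N : nat)
    (xi : 'I_N.+1 -> R) (X : E -> 'rV[R]_2 -> 'rV[R]_3)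
    (adj : E -> edge -> E * edge) (coin : E -> edge -> 'I_N.+1 -> 'I_N.+1) :
    Prop :=
  forall e a k,
    X (adj e a).1 (edge_point (adj e a).2 (xi (coin e a k)))
    = X e (edge_point a (xi k)).

(* An element-local topography may jump across interfaces; it is continuous
   when it is the pull-back of a continuous function on the surface. *)
Definition continuous_topography (R : realType) (E : finType)
    (S : set 'rV[R]_3) (X : E -> 'rV[R]_2 -> 'rV[R]_3)
    (b : E -> 'rV[R]_2 -> R) : Prop :=
  exists bS : 'rV[R]_3 -> R, {within S, continuous bS} /\
    forall e x, square R x -> b e x = bS (X e x).

(** * Pointwise data and fluxes *)

Definition levi_civita (R : realType) (j k : 'I_2) : R :=
  if (j < k)%N then 1 else if (k < j)%N then -1 else 0.

Definition vec3 (R : realType) (a : R) (F : 'I_2 -> R) : 'rV[R]_3 :=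
  \row_(c < 3) oapp F a (unlift ord0 c).

Definition depth (R : realType) (u : 'rV[R]_3) : R := u ord0 ord0.
Definition momentum (R : realType) (u : 'rV[R]_3) (i : 'I_2) : R :=
  u ord0 (lift ord0 i).
Definition vel (R : realType) (u : 'rV[R]_3) (i : 'I_2) : R :=
  momentum u i / depth u.

Record point_data (R : realType) := PointData {
  pG : 'M[R]_2;
  pu : 'rV[R]_3;
  pb : R }.

Section Flux.
Variables (R : realType) (g : R).
Implicit Types L P : point_data R.

Definition ph P : R := depth (pu P).
Definition pv P (i : 'I_2) : R := vel (pu P) i.
Definition pvcov P (i : 'I_2) : R := \sum_j pG P i j * pv P j.
Definition pJ P : R := Num.sqrt (\det (pG P)).
Definition pGinv P : 'M[R]_2 := invmx (pG P).

Definition volume_flux (j : 'I_2) L P : 'rV[R]_3 :=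
  vec3
    (2^-1 * (pJ L * ph L * pv L j + pJ P * ph P * pv P j))
    (fun i =>
       4^-1 * (pJ L * ph L * pv L j * pv L i + pJ P * ph P * pv P j * pv P i
               + pJ P * ph P * pv P j * pv L i
               + \sum_k pGinv L i k * pJ L * ph L * pv L j * pvcov P k)
       + g / 2 * (pGinv L i j * pJ L * ph L) * ph P
       + g / 2 * (pGinv L i j * pJ L * ph L) * (pb P - pb L)).

Definition wave_speed (j : 'I_2) P : R :=
  `|pv P j| + Num.sqrt (g * ph P * pGinv P j j).

(* All geometric quantities are expected to be those of [L] for both arguments,
   i.e. [pG P = pG L]. *)
Definition interface_flux (j : 'I_2) L P : 'rV[R]_3 :=
  volume_flux j L P
  - (pJ L / 2 * Num.max (wave_speed j L) (wave_speed j P)) *: (pu P - pu L).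

End Flux.

(** * Semi-discretization *)

Section Scheme.
Variables (R : realType) (E : finType) (N : nat).
Variables (xi : 'I_N.+1 -> R).
Variables (X : E -> 'rV[R]_2 -> 'rV[R]_3).
Variables (adj : E -> edge -> E * edge).
Variables (coin : E -> edge -> 'I_N.+1 -> 'I_N.+1).
Variables (b : E -> 'rV[R]_2 -> R) (f : 'rV[R]_3 -> R) (g : R).

Definition state : Type := E -> 'I_N.+1 -> 'I_N.+1 -> 'rV[R]_3.
Implicit Types (U : state) (e : E) (a : edge).

Definition velocity U e i j : 'rV[R]_3 :=
  \sum_(k < 2) vel (U e i j) k *: tangent (X e) k (node xi i j).

Definition inner_data U e i j : point_data R :=
  PointData (metric (X e) (node xi i j)) (U e i j) (b e (node xi i j)).

(* The external data at the [k]-th node on edge [a] of [e].  The depth and the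
   topography are those of the adjacent element; the contravariant velocity
   components of the tangent vector [w] of the adjacent element in the local
   basis of the interior node are G^{ij} (a_j . w). *)
Definition outer_data U e a k : point_data R :=
  let x := node xi (edge_index a k).1 (edge_index a k).2 in
  let e' := (adj e a).1 in
  let n' := edge_index (adj e a).2 (coin e a k) in
  let h' := depth (U e' n'.1 n'.2) in
  let w := velocity U e' n'.1 n'.2 in
  PointData (metric (X e) x)
    (vec3 h' (fun i => h' * \sum_j invmx (metric (X e) x) i j
                                   * vdot (tangent (X e) j x) w))
    (b e' (node xi n'.1 n'.2)).

Definition numerical_flux U e a k : 'rV[R]_3 :=
  interface_flux g a.1
    (inner_data U e (edge_index a k).1 (edge_index a k).2)
    (outer_data U e a k).

Definition source U e (n1 n2 : 'I_N.+1) : 'rV[R]_3 :=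
  let x := node xi n1 n2 in
  let P := inner_data U e n1 n2 in
  vec3 0 (fun i =>
    - 2^-1 * (\sum_j \sum_k christoffel (X e) i j k x * ph P * pv P j * pv P k
              - \sum_j \sum_k \sum_l pGinv P i k * christoffel (X e) l j k x
                                      * ph P * pv P j * pvcov P l)
    - \sum_j \sum_k f (X e x) * pJ P * pGinv P i j * levi_civita R j k
                     * ph P * pv P k).

Definition scheme_rhs U e i j : 'rV[R]_3 :=
  let w := lgl_weight xi in
  let d1 : 'I_2 := ord0 in
  let d2 : 'I_2 := ord_max in
  w j *: (- (\sum_m Smx xi i m *:
               volume_flux g d1 (inner_data U e i j) (inner_data U e m j))
          + (i == ord0)%:R *: numerical_flux U e (d1, false) j
          - (i == ord_max)%:R *: numerical_flux U e (d1, true) j)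
  + w i *: (- (\sum_m Smx xi j m *:
                 volume_flux g d2 (inner_data U e i j) (inner_data U e i m))
            + (j == ord0)%:R *: numerical_flux U e (d2, false) i
            - (j == ord_max)%:R *: numerical_flux U e (d2, true) i)
  + (w i * w j * pJ (inner_data U e i j)) *: source U e i j.

Definition solution (I : set R) (u : E -> 'I_N.+1 -> 'I_N.+1 -> R -> 'rV[R]_3) :
    Prop :=
  forall t, I t -> forall e i j,
    let U : state := fun e i j => u e i j t in
    [/\ 0 < depth (u e i j t),
        derivable (u e i j) t 1 &
        (lgl_weight xi i * lgl_weight xi j * pJ (inner_data U e i j))
          *: derive1 (u e i j) t = scheme_rhs U e i j].

Definition lake_at_rest U : Prop :=
  (exists c : R, forall e i j,
      depth (U e i j) + b e (node xi i j) = c) /\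
  (forall e i j, velocity U e i j = 0).

End Scheme.

(* Main.v *)
Require Import Defs.
From mathcomp Require Import all_boot all_order all_algebra.
From mathcomp Require Import all_classical all_reals all_analysis.
From mathcomp Require Import ring.
Import Order.TTheory GRing.Theory Num.Theory.
Import numFieldNormedType.Exports.
Local Open Scope classical_set_scope.
Local Open Scope ring_scope.

Set Implicit Arguments.
Unset Strict Implicit.

(** Fix an element and write L for a node and P for another node of the same
    grid line, or for the exterior state across an interface.  With vanishing
    velocity, only the pressure and topography terms of the volume flux survive,
    and they add up to g/2 (G^{ij} J h)_L (h_P + b_P - b_L).  As h + b is
    constant, this equals g/2 (G^{ij} J h)_L h_L, which no longer depends on P
    ([volume_flux_still]).  The volume sum is therefore this constant vector
    times the row sum of S, and the row sum of S is minus the diagonal entry of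
    B, because the Lagrange polynomials add up to 1 and D annihilates constants
    ([Smx_row_sum]).  Across an interface the continuity of b forces the two
    depths to agree, so the dissipation vanishes and the interface flux is the
    same constant vector ([numerical_flux_rest]); the surface terms then cancel
    the volume sum ([flux_line_cancel]).  The source term is quadratic in v up
    to the Coriolis term, which is linear in v, so it vanishes as well.

    Two points remain.  A vanishing velocity vector must give vanishing
    components, which is the linear independence of the tangents, i.e. the
    positive definiteness of G ([velocity_eq0]).  And the factor
    w_i w_j J in front of du/dt must be nonzero.  For J this is det G > 0.  For
    the weights, given by 2 / (N (N+1) L_N(xi_i)^2), it says that the Legendre
    polynomial L_N does not vanish at the nodes: by the Legendre differential
    equation, in the form of a recurrence between successive derivatives of
    (X^2 - 1)^N, a common zero of L_N and L_N', or a zero at 1 or -1, would be a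
    zero of all the higher derivatives, among them the nonzero constant
    (2N)! ([legendre_neq0]). *)

(** * The Legendre polynomial does not vanish at the nodes *)

Section LegendreNodes.
Variables (R : realType) (N : nat).

Let p : {poly R} := ('X^2 - 1) ^+ N.

(** Legendre's equation at every order of differentiation: it is the (k + 1)-st
    derivative of (X^2 - 1) p' = 2 N X p, and its case k = N is the usual
    Legendre equation for p^`(N). *)
Lemma rodrigues_recurrence (k : nat) :
  ('X^2 - 1) * p^`(k.+2) + (k.+1%:R - N%:R) *+ 2 * 'X * p^`(k.+1)
  + k.+1%:R * (k%:R - N%:R *+ 2) * p^`(k) = 0.
Proof.
have deriv_nat n : (n%:R : {poly R})^`() = 0 by rewrite -polyC_natr derivC.
have deriv_1 : (1 : {poly R})^`() = 0 := deriv_nat 1%N.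
have derivE := (derivD, derivN, derivXn, derivX, derivMn, derivM, deriv_1,
                deriv_nat, deriv0).
have first_order : ('X^2 - 1) * p^`() - N%:R *+ 2 * 'X * p = 0.
  rewrite /p; case: (N) => [|n].
    by rewrite expr0 deriv_1; ring.
  by rewrite deriv_exp /= !derivE /= -mulr_natl [_ ^+ n.+1]exprS; ring.
elim: k => [|k IH].
  have := congr1 deriv first_order.
  rewrite !derivE /= expr1 => first_order'.
  by rewrite -[RHS]first_order'; ring.
have := congr1 deriv IH.
rewrite !derivE -!derivnS /= expr1 => IH'.
by rewrite -[RHS]IH' -!natr1; ring.
Qed.

(** If L_N(x) = 0, the recurrence at x propagates the zero to every derivative
    of (X^2 - 1)^N of order at least N, although the one of order 2N is (2N)!.  For x^2 <> 1 its leading coefficient is x^2 - 1 and two initial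
    zeros are needed; for x^2 = 1 it degenerates to a first-order recurrence
    and one initial zero is enough. *)
Lemma legendre_neq0 (x : R) :
  x ^+ 2 = 1 \/ root (legendre R N)^`() x -> (legendre R N).[x] != 0.
Proof.
have scale_neq0 : ((2 ^ N * N`!)%:R : R)^-1 != 0.
  by rewrite invr_neq0 // pnatr_eq0 muln_eq0 negb_or expn_eq0 /= -lt0n fact_gt0.
rewrite /legendre -/p derivZ -derivnS !rootE !hornerZ.
rewrite !mulf_eq0 !(negbTE scale_neq0) /= => hx; apply/negP => /eqP LN0.
have hx' : x ^+ 2 = 1 \/ (p^`(N.+1)).[x] = 0 by case: hx => [|/eqP]; [left|right].
have rec k : (x ^+ 2 - 1) * (p^`(k.+2)).[x]
    + (k.+1%:R - N%:R) *+ 2 * x * (p^`(k.+1)).[x]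
    + k.+1%:R * (k%:R - N%:R *+ 2) * (p^`(k)).[x] = 0.
  have := congr1 (horner^~ x) (rodrigues_recurrence k).
  have horner_nat n : (n%:R : {poly R}).[x] = n%:R by rewrite -polyC_natr hornerC.
  have hornerE' := (hornerD, hornerN, hornerM, hornerXn, hornerX, horner_nat 1%N).
  by rewrite !(hornerE', hornerMn, horner_nat) horner0.
(* The second component lets one induction treat both kinds of points. *)
have all0 k : (p^`(N + k)).[x] = 0 /\ (x ^+ 2 = 1 \/ (p^`((N + k).+1)).[x] = 0).
  elim: k => [|k [IH0 IH1]]; first by rewrite addn0.
  rewrite addnS; have := rec (N + k)%N; rewrite IH0 mulr0 addr0.
  case: IH1 => [x21|IH1]; last first.
    rewrite IH1 mulr0 addr0 => /eqP; rewrite mulf_eq0 => h; split=> //.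
    by case/orP: h => /eqP h; [left; apply/eqP; rewrite -subr_eq0 h|right].
  rewrite x21 subrr mul0r add0r => /eqP; rewrite mulf_eq0 => h; split; last by left.
  (* The coefficient of the next derivative is 2 (k + 1) x, which is nonzero. *)
  apply/eqP; case/orP: h => //; rewrite mulf_eq0 mulrn_eq0 /= => /orP[].
    by rewrite -natr1 natrD addrAC [_ + _ - _]addrAC subrr add0r natr1 pnatr_eq0.
  by move/eqP=> x0; move/eqP: x21; rewrite x0 expr0n eq_sym oner_eq0.
have monic_p : p \is monic by rewrite monic_exp // -polyC1 monicXnsubC.
have size_p : size p = (N + N).+1.
  by rewrite (polySpred (monic_neq0 monic_p)) size_exp size_Xn_sub_1 // mul2n addnn.
have const : p^`(N + N) = ((N + N)`!%:R)%:P.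
  rewrite [LHS]size1_polyC.
    rewrite coef_derivn addn0 ffactnn; move: monic_p.
    by rewrite monicE lead_coefE size_p /= => /eqP->.
  apply/leq_sizeP => -[//|i] _; rewrite coef_derivn.
  by rewrite nth_default ?mul0rn // size_p addnS ltnS leq_addr.
have [+ _] := all0 N; rewrite const hornerC => /eqP.
by rewrite pnatr_eq0 -leqn0 leqNgt fact_gt0.
Qed.

End LegendreNodes.

(** * Collocation on a grid line *)

Section Collocation.
Variables (R : realType) (N : nat) (xi : 'I_N.+1 -> R) (hxi : lgl_nodes xi).

Lemma lgl_le (i j : 'I_N.+1) : (i <= j)%N -> xi i <= xi j.
Proof.
rewrite leq_eqVlt => /orP[/eqP/val_inj->|]; first exact: lexx.
by move=> /(lgl_incr hxi)/ltW.
Qed.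

Lemma lgl_inj : injective xi.
Proof.
move=> i j eq_xi; apply/val_inj; case: (ltngtP i j) => // /(lgl_incr hxi);
by rewrite eq_xi ltxx.
Qed.

Lemma lgl_range (i : 'I_N.+1) : -1 <= xi i <= 1.
Proof.
by rewrite -(lgl_first hxi) -(lgl_last hxi) !lgl_le // leq_ord.
Qed.

Lemma lgl_weight_neq0 (i : 'I_N.+1) : (0 < N)%N -> lgl_weight xi i != 0.
Proof.
move=> N_gt0; rewrite /lgl_weight mulf_neq0 ?pnatr_eq0 // invr_neq0 //.
rewrite mulf_neq0 ?pnatr_eq0 -?lt0n ?muln_gt0 ?N_gt0 // expf_neq0 //.
apply: legendre_neq0.
have [->|i0] := eqVneq i ord0; first by left; rewrite (lgl_first hxi) sqrrN expr1n.
have [->|iN] := eqVneq i ord_max; first by left; rewrite (lgl_last hxi) expr1n.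
by right; exact: (lgl_inner hxi).
Qed.

Lemma lagrange_poly_sample (i j : 'I_N.+1) :
  (lagrange_poly xi j).[xi i] = (i == j)%:R.
Proof.
rewrite /lagrange_poly horner_prod; have [->|ij] := eqVneq i j.
  apply: big1 => k kj; rewrite !hornerE mulVf // subr_eq0.
  by apply: contraNneq kj => /lgl_inj ->.
by rewrite (bigD1 i) //= !hornerE subrr mulr0 mul0r.
Qed.

Lemma size_lagrange_poly (j : 'I_N.+1) : (size (lagrange_poly xi j) <= N.+1)%N.
Proof.
rewrite /lagrange_poly scaler_prod (leq_trans (size_scale_leq _ _)) //.
rewrite -big_filter size_prod_XsubC size_filter -sum1_count sum1_card ltnS.
by rewrite (eq_card (_ : _ =i predC1 j)) // cardC1 card_ord.
Qed.

(** Both sides have degree at most N and agree at N + 1 points. *)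
Lemma lagrange_poly_sum1 : \sum_j lagrange_poly xi j = 1.
Proof.
apply/eqP; rewrite -subr_eq0; apply/negPn/negP => /max_poly_roots.
move=> /(_ (codom xi)); rewrite size_codom card_ord => bound.
have: (N.+1 < size (\sum_j lagrange_poly xi j - 1)%R)%N.
  apply: bound; last by rewrite map_inj_uniq ?enum_uniq //; exact: lgl_inj.
  apply/allP => _ /codomP[i ->]; rewrite rootE !hornerE horner_sum.
  rewrite (bigD1 i) //= lagrange_poly_sample eqxx big1 ?addr0 ?subrr // => j ji.
  by rewrite lagrange_poly_sample eq_sym (negbTE ji).
apply/negP; rewrite -leqNgt (leq_trans (size_polyD _ _)) //.
rewrite geq_max size_polyN size_poly1 andbT.
rewrite (leq_trans (size_sum _ _ _)) //; apply/bigmax_leqP => j _.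
exact: size_lagrange_poly.
Qed.

(** Since 2 Q = 2 M D kills constants, only B contributes. *)
Lemma Smx_row_sum (i : 'I_N.+1) :
  \sum_m Smx xi i m = (i == ord0)%:R - (i == ord_max)%:R.
Proof.
have Drow : \sum_m Dmx xi i m = 0.
  under eq_bigr do rewrite mxE.
  by rewrite -horner_sum -linear_sum lagrange_poly_sum1 -polyC1 /= derivC horner0.
have Sentry m : Smx xi i m = 2 * lgl_weight xi i * Dmx xi i m
    - ((i == ord_max)%:R - (i == ord0)%:R) *+ (i == m).
  rewrite /Smx /Qmx /Mmx /Bmx mul_diag_mx !mxE !mulrA.
  by have [->|//] := eqVneq i m.
under eq_bigr do rewrite Sentry.
rewrite sumrB -mulr_sumr Drow mulr0 sub0r (bigD1 i) //= eqxx big1 ?addr0 ?opprB //.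
by move=> m; rewrite eq_sym => /negbTE->.
Qed.

(** Free-stream preservation in one direction: a two-point flux that does not
    depend on its second argument is weighted by the row sum of S, which the
    two surface terms compensate. *)
Lemma flux_line_cancel (V : lmodType R) (i : 'I_N.+1) (F : V) (Fm : 'I_N.+1 -> V)
    (F0 FN : V) :
    (forall m, Fm m = F) -> (i = ord0 -> F0 = F) -> (i = ord_max -> FN = F) ->
  - (\sum_m Smx xi i m *: Fm m) + (i == ord0)%:R *: F0
    - (i == ord_max)%:R *: FN = 0.
Proof.
move=> eqFm eqF0 eqFN; under eq_bigr do rewrite eqFm.
rewrite -scaler_suml Smx_row_sum.
have -> : (i == ord0)%:R *: F0 = (i == ord0)%:R *: F.
  by case: eqP => [/eqF0->|]; rewrite ?scale0r.
have -> : (i == ord_max)%:R *: FN = (i == ord_max)%:R *: F.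
  by case: eqP => [/eqFN->|]; rewrite ?scale0r.
by rewrite scalerBl opprB subrK subrr.
Qed.

Lemma square_node (i j : 'I_N.+1) : square R (node xi i j).
Proof. by move=> k; rewrite mxE; case: ifP => _; exact: lgl_range. Qed.

Lemma edge_point_node (a : edge) (k : 'I_N.+1) :
  edge_point a (xi k) = node xi (edge_index a k).1 (edge_index a k).2.
Proof.
have end_node (s : bool) :
    (if s then 1 else -1) = xi (if s then ord_max else ord0).
  by case: s; rewrite ?(lgl_first hxi) ?(lgl_last hxi).
case: a => d s; apply/rowP => l; rewrite !mxE /edge_index /= end_node.
have [->|d0] := eqVneq d ord0; first by rewrite eq_sym.
have -> : d = ord_max by apply/val_inj; case: d d0 => -[|[|]].
by case: l => -[|[|//]] ?.
Qed.

End Collocation.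

(** * Consequences of the positive definiteness of the metric *)

Section Geometry.
Variables (R : realType).

Lemma posdef2_det_gt0 (G : 'M[R]_2) : posdef G -> 0 < \det G.
Proof.
move=> [symG posG]; set a := G ord0 ord0; set b := G ord0 ord_max.
set d := G ord_max ord_max.
have Gba : G ord_max ord0 = b by rewrite -[in LHS]symG mxE.
have detG : \det G = a * d - b ^+ 2.
  rewrite (expand_det_row _ ord0) !big_ord_recl big_ord0 addr0.
  rewrite /cofactor !det_mx11 !mxE -/a.
  have -> : lift ord0 ord0 = ord_max :> 'I_2 by apply/val_inj.
  have -> : lift ord_max 0 = ord0 :> 'I_2 by apply/val_inj.
  by rewrite Gba -/b -/d /= expr0 expr1; ring.
have form (x y : R) : let w := \row_(k < 2) (if k == ord0 then x else y) in
    (w *m G *m w^T) ord0 ord0 = x ^+ 2 * a + 2 * x * y * b + y ^+ 2 * d.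
  rewrite /= !mxE !big_ord_recl big_ord0 !mxE !big_ord_recl !big_ord0 !mxE /=.
  have -> : lift ord0 ord0 = ord_max :> 'I_2 by apply/val_inj.
  by rewrite Gba -/a -/b -/d; ring.
have row_neq0 (x y : R) : (x != 0) || (y != 0) ->
    \row_(k < 2) (if k == ord0 then x else y) != 0.
  apply: contraTneq => /rowP w0; move: (w0 ord0) (w0 ord_max).
  by rewrite !mxE /= => -> ->; rewrite eqxx.
have a_gt0 : 0 < a.
  have := posG _ (row_neq0 1 0 _); rewrite form oner_neq0 => /(_ isT).
  by congr (0 < _); ring.
(* This vector is G-orthogonal to the first basis vector, so the quadratic form
   takes the value a det G at it. *)
have := posG _ (row_neq0 (- b) a _); rewrite form orbC gt_eqF // => /(_ isT).
have -> : (- b) ^+ 2 * a + 2 * - b * a * b + a ^+ 2 * d = a * \det G.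
  by rewrite detG; ring.
by rewrite pmulr_rgt0.
Qed.

(** The quadratic form of the Gram matrix at v is the squared norm of the tangent
    vector with components v. *)
Lemma velocity_eq0 (T : 'I_2 -> 'rV[R]_3) (v : 'I_2 -> R) :
  posdef (\matrix_(i, j) vdot (T i) (T j)) -> \sum_k v k *: T k = 0 ->
  forall k, v k = 0.
Proof.
move=> [_ pos] comb0 k; have [w0|/pos] := eqVneq (\row_i v i) 0.
  by have := congr1 (fun w : 'rV_2 => w ord0 k) w0; rewrite !mxE.
suff -> : \row_i v i *m (\matrix_(i, j) vdot (T i) (T j)) = 0.
  by rewrite mul0mx mxE ltxx.
apply/rowP => j; rewrite !mxE.
transitivity (vdot (\sum_i v i *: T i) (T j)); last first.
  by rewrite comb0 /vdot big1 // => l _; rewrite mxE mul0r.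
under eq_bigr do rewrite !mxE /vdot mulr_sumr.
rewrite exchange_big; apply: eq_bigr => l _.
by rewrite summxE mulr_suml; apply: eq_bigr => i _; rewrite !mxE mulrA.
Qed.
End Geometry.

(** * Fluxes at rest *)

Section Fluxes.
Variables (R : realType) (g : R).
Implicit Types L P : point_data R.

(** The pressure and topography terms combine into
    g/2 (G^{ij} J h)_L (h_P + b_P - b_L), which the lake-at-rest identity turns
    into g/2 (G^{ij} J h)_L h_L.  The metric terms of P only occur multiplied by
    velocities, so the two points may have different metrics. *)
Lemma volume_flux_still (j : 'I_2) L P :
    (forall i, pv L i = 0) -> (forall i, pv P i = 0) ->
    ph P + pb P = ph L + pb L ->
  volume_flux g j L P = volume_flux g j L L.
Proof.
move=> vL vP lake; apply/rowP => q; rewrite !mxE.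
case: unliftP => [i _|_] /=; last by rewrite !vL !vP !mulr0.
have cov0 Q : (forall i, pv Q i = 0) -> forall k, pvcov Q k = 0.
  by move=> vQ k; rewrite /pvcov big1 // => l _; rewrite vQ mulr0.
rewrite !big1 => [|k _|k _]; try by rewrite cov0 // mulr0.
have -> : pb P = ph L + pb L - ph P by rewrite -lake addrAC subrr add0r.
by rewrite !vL !vP; ring.
Qed.

Lemma interface_flux_still (j : 'I_2) L P :
    (forall i, pv L i = 0) -> pu P = pu L -> pb P = pb L ->
  interface_flux g j L P = volume_flux g j L L.
Proof.
move=> vL eq_u eq_b; rewrite /interface_flux eq_u subrr scaler0 subr0.
by apply: volume_flux_still => //; rewrite /pv /ph ?eq_u ?eq_b.
Qed.
End Fluxes.

(** * The lake at rest *)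

Section Rest.
Variables (R : realType) (E : finType) (N : nat).
Variables (c : 'rV[R]_3) (r : R) (xi : 'I_N.+1 -> R).
Variables (X : E -> 'rV[R]_2 -> 'rV[R]_3).
Variables (adj : E -> edge -> E * edge).
Variables (coin : E -> edge -> 'I_N.+1 -> 'I_N.+1).
Variables (b : E -> 'rV[R]_2 -> R) (f : 'rV[R]_3 -> R) (g : R).
Variable U : E -> 'I_N.+1 -> 'I_N.+1 -> 'rV[R]_3.
Hypothesis hmesh : conforming_mesh (sphere c r) X adj.
Hypothesis hxi : lgl_nodes xi.
Hypothesis hcoin : coincident_nodes xi X adj coin.
Hypothesis hb : continuous_topography (sphere c r) X b.
Hypothesis depth_gt0 : forall e i j, 0 < depth (U e i j).
Hypothesis hrest : lake_at_rest xi X b U.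

Lemma rest_vel e i j k : vel (U e i j) k = 0.
Proof.
have /= pos := mesh_posdef hmesh e (square_node hxi i j).
have /= v0 := proj2 hrest e i j.
exact: velocity_eq0 pos v0 k.
Qed.

Lemma rest_momentum e i j k : momentum (U e i j) k = 0.
Proof.
have /eqP := rest_vel e i j k; rewrite mulf_eq0 invr_eq0.
by rewrite (gt_eqF (depth_gt0 e i j)) orbF => /eqP.
Qed.

(** The two local topographies are pulled back from one function on the surface,
    and coincident nodes have the same image there. *)
Lemma topography_coincident e a k :
  pb (outer_data xi X adj coin b U e a k)
  = b e (node xi (edge_index a k).1 (edge_index a k).2).
Proof.
have [bS [_ bE]] := hb.
rewrite /= !bE; try exact: square_node.
by rewrite -!(edge_point_node hxi) hcoin.
Qed.

(** Equal topographies force equal depths, because h + b is the same constant in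
    both elements; the two states are then equal and the dissipation drops
    out. *)
Lemma numerical_flux_rest e a k :
  let L := inner_data xi X b U e (edge_index a k).1 (edge_index a k).2 in
  numerical_flux xi X adj coin b g U e a k = volume_flux g a.1 L L.
Proof.
apply: interface_flux_still; last exact: topography_coincident.
  by move=> i; exact: rest_vel.
have [[C lake] v0] := hrest.
apply/rowP => q; rewrite mxE v0; case: unliftP => [i ->|->] /=.
  rewrite big1 => [|j _]; first by rewrite mulr0 [RHS]rest_momentum.
  by rewrite /vdot big1 ?mulr0 // => l _; rewrite mxE mulr0.
set n := edge_index a k; set n' := edge_index _ _.
apply: (@addIr _ (b e (node xi n.1 n.2))).
by rewrite -{1}topography_coincident /= [LHS]lake [RHS]lake.
Qed.

Lemma source_rest e i j : source xi X b f U e i j = 0.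
Proof.
have v0 k : pv (inner_data xi X b U e i j) k = 0 by exact: rest_vel.
apply/rowP => q; rewrite !mxE; case: unliftP => [k _|_] //=.
rewrite !big1 ?subrr ?mulr0 ?subr0 // => l _; rewrite big1 // => m _.
- by rewrite v0 mulr0.
- by rewrite big1 // => ? _; rewrite v0 mulr0 mul0r.
- by rewrite !v0 mulr0.
Qed.

Lemma scheme_rhs_rest e i j : scheme_rhs xi X adj coin b f g U e i j = 0.
Proof.
have flux_const d m n m' n' :
    volume_flux g d (inner_data xi X b U e m n) (inner_data xi X b U e m' n')
    = volume_flux g d (inner_data xi X b U e m n) (inner_data xi X b U e m n).
  apply: volume_flux_still => [k|k|]; [exact: rest_vel..|].
  by have [[C lake] _] := hrest; rewrite [LHS]lake [RHS]lake.
rewrite /scheme_rhs source_rest scaler0 addr0.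
rewrite (flux_line_cancel hxi (flux_const _ _ _ ^~ _)); first last.
- by move=> ->; rewrite numerical_flux_rest.
- by move=> ->; rewrite numerical_flux_rest.
rewrite (flux_line_cancel hxi (flux_const _ _ _ _)) ?scaler0 ?addr0 //.
- by move=> ->; rewrite numerical_flux_rest.
- by move=> ->; rewrite numerical_flux_rest.
Qed.
End Rest.

Theorem theorem3 (R : realType)
  (c : 'rV[R]_3) (r : R) (hr : 0 < r)
  (E : finType) (X : E -> 'rV[R]_2 -> 'rV[R]_3)
  (adj : E -> edge -> E * edge)
  (hmesh : conforming_mesh (sphere c r) X adj)
  (N : nat) (hN : (0 < N)%N)
  (xi : 'I_N.+1 -> R) (hxi : lgl_nodes xi)
  (coin : E -> edge -> 'I_N.+1 -> 'I_N.+1)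
  (hcoin : coincident_nodes xi X adj coin)
  (g : R) (hg : 0 < g) (f : 'rV[R]_3 -> R)
  (b : E -> 'rV[R]_2 -> R)
  (hb : continuous_topography (sphere c r) X b)
  (I : set R) (hI : open I)
  (u : E -> 'I_N.+1 -> 'I_N.+1 -> R -> 'rV[R]_3)
  (hu : solution xi X adj coin b f g I u)
  (t : R) (ht : I t)
  (hrest : lake_at_rest xi X b (fun e i j => u e i j t)) :
  forall (e : E) (i j : 'I_N.+1), derive1 (u e i j) t = 0.
Proof.
move=> e i j; have [_ _ /eqP] := hu t ht e i j.
rewrite (scheme_rhs_rest f g hmesh hxi hcoin hb _ hrest); last first.
  by move=> e' i' j'; have [] := hu t ht e' i' j'.
suff /negbTE factor_neq0 :
    lgl_weight xi i * lgl_weight xi j * pJ (inner_data xi X b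
      (fun e i j => u e i j t) e i j) != 0.
  by rewrite scaler_eq0 factor_neq0 => /eqP.
apply: mulf_neq0; first by apply: mulf_neq0; exact: lgl_weight_neq0.
rewrite /pJ sqrtr_eq0 -ltNge.
exact: posdef2_det_gt0 (mesh_posdef hmesh e (square_node hxi i j)).
Qed.
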